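(* The Lorentzian Lie algebra $(\mathfrak g_4,S_A^-,J)$ is flat with respect to the Kobayashi-Nomizu connection $\nabla^1$, i.e. $R^1_{uv}w=0$ for all $u,v,w\in\mathfrak g_4$.
   Context: $\mathfrak g_4$ is the real Lie algebra with basis $e_1,e_2,e_3,e_4$ and non-zero brackets (up to skew-symmetry) $[e_1,e_2]=e_3$, $[e_1,e_3]=e_4$. $S_A^-$ is the Lorentzian inner product $\langle\cdot,\cdot\rangle$ on $\mathfrak g_4$ whose matrix in $(e_1,e_2,e_3,e_4)$ is $\begin{bmatrix}-1&0&0&0\\0&1&0&0\\0&0&a&b\\0&0&b&c\end{bmatrix}$, where $A=\begin{bmatrix}a&b\\ b&c\end{bmatrix}$ is real symmetric positive definite. Put $d=ac-b^2$ and fix the basis $v_1=e_2$, $v_2=\frac1{\sqrt a}e_3$, $v_3=\frac{-b}{\sqrt{ad}}e_3+\sqrt{\frac ad}\,e_4$, $v_4=e_1$, which is orthonormal: $\langle v_i,v_j\rangle=0$ for $i\ne j$, $\langle v_i,v_i\rangle=1$ for $i=1,2,3$, $\langle v_4,v_4\rangle=-1$. The product structure $J$ is the linear map with $Jv_i=v_i$ for $i=1,2,3$ and $Jv_4=-v_4$. Write $\mathfrak g$ for the Lie algebra. The Levi-Civita connection is the bilinear map $\nabla:\mathfrak g\times\mathfrak g\to\mathfrak g$ with $2\langle\nabla_uv,w\rangle=\langle[u,v],w\rangle+\langle[w,u],v\rangle+\langle[w,v],u\rangle$ for all $u,v,w$. Put $(\nabla_uJ)v=\nabla_u(Jv)-J(\nabla_uv)$.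 The canonical connection is $\nabla^0_uv=\nabla_uv-\frac12(\nabla_uJ)Jv$, the Kobayashi-Nomizu connection is $\nabla^1_uv=\nabla^0_uv-\frac14\left[(\nabla_vJ)Ju-(\nabla_{Jv}J)u\right]$, and the curvature of $\nabla^1$ is $R^1_{uv}w=\nabla^1_{[u,v]}w-\nabla^1_u\nabla^1_vw+\nabla^1_v\nabla^1_uw$. *)

(* Defs.v *)
From HB Require Import structures.
From mathcomp Require Import all_boot all_order all_algebra.
From mathcomp Require Import ring lra.
From mathcomp Require Import reals.

Set Implicit Arguments.
Unset Strict Implicit.
Unset Printing Implicit Defensive.

Import Order.TTheory GRing.Theory Num.Theory.
Local Open Scope ring_scope.

Section Connections.
Variables (R : fieldType) (V : lmodType R).
Implicit Types (br nabla : V -> V -> V) (J : V -> V) (u v w : V).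

Definition levi_civita br (g : V -> V -> R) (nabla : {bilinear V -> V -> V}) :=
  forall u v w,
    2 * g (nabla u v) w = g (br u v) w + g (br w u) v + g (br w v) u.

(* (nabla_u J) v *)
Definition cov_deriv nabla J u v := nabla u (J v) - J (nabla u v).

Definition canonical_connection nabla J u v :=
  nabla u v - 2^-1 *: cov_deriv nabla J u (J v).

Definition kobayashi_nomizu nabla J u v :=
  canonical_connection nabla J u v
  - 4^-1 *: (cov_deriv nabla J v (J u) - cov_deriv nabla J (J v) u).

Definition curvature br nabla u v w :=
  nabla (br u v) w - nabla u (nabla v w) + nabla v (nabla u w).

Definition flat br nabla := forall u v w, curvature br nabla u v w = 0.

End Connections.

Section G4.
Variable R : realType.
Implicit Types (A : 'M[R]_2) (u v w : 'rV[R]_4).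

(* Indices start at 0: 'e_0, ..., 'e_3 are e_1, ..., e_4. *)
Definition bracket u v : 'rV[R]_4 :=
  (u 0 0 * v 0 1 - u 0 1 * v 0 0) *: 'e_2
  + (u 0 0 * v 0 2 - u 0 2 * v 0 0) *: 'e_3.

Definition posdef A :=
  A^T = A /\ forall x : 'cV[R]_2, x != 0 -> 0 < (x^T *m A *m x) 0 0.

Definition lorentz_mx A : 'M[R]_4 :=
  \matrix_(i, j) nth 0 (nth [::] [:: [:: -1; 0; 0; 0];
                                     [::  0; 1; 0; 0];
                                     [::  0; 0; A 0 0; A 0 1];
                                     [::  0; 0; A 1 0; A 1 1]] i) j.

Definition lorentz_form A u v : R := (u *m lorentz_mx A *m v^T) 0 0.

Definition v1 : 'rV[R]_4 := 'e_1.
Definition v2 A : 'rV[R]_4 := (Num.sqrt (A 0 0))^-1 *: 'e_2.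
Definition v3 A : 'rV[R]_4 :=
  let a := A 0 0 in let b := A 0 1 in let c := A 1 1 in
  let d := a * c - b ^+ 2 in
  (- b / Num.sqrt (a * d)) *: 'e_2 + Num.sqrt (a / d) *: 'e_3.
Definition v4 : 'rV[R]_4 := 'e_0.

Definition product_structure A (J : {linear 'rV[R]_4 -> 'rV[R]_4}) :=
  [/\ J v1 = v1, J (v2 A) = v2 A, J (v3 A) = v3 A & J v4 = - v4].

Let V4P (x y : 'rV[R]_4) : x 0 0 = y 0 0 -> x 0 1 = y 0 1 -> x 0 2 = y 0 2 ->
  x 0 3 = y 0 3 -> x = y.
Proof.
move=> h0 h1 h2 h3; apply/rowP => -[[|[|[|[|//]]]] hi].
- by rewrite (_ : Ordinal hi = 0)//; apply/val_inj.
- by rewrite (_ : Ordinal hi = 1)//; apply/val_inj.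
- by rewrite (_ : Ordinal hi = 2)//; apply/val_inj.
- by rewrite (_ : Ordinal hi = 3)//; apply/val_inj.
Qed.

Fact bracket_e1e2 : bracket 'e_0 'e_1 = 'e_2.
Proof. by apply: V4P; rewrite !mxE /=; ring. Qed.

Fact bracket_e1e3 : bracket 'e_0 'e_2 = 'e_3.
Proof. by apply: V4P; rewrite !mxE /=; ring. Qed.

Fact bracket_bilinear : bilinear_for *:%R *:%R bracket.
Proof. by split=> [u|u] k v w; apply: V4P; rewrite !mxE /=; ring. Qed.

Fact bracket_alt u : bracket u u = 0.
Proof. by apply: V4P; rewrite !mxE /=; ring. Qed.

Fact jacobi u v w : bracket u (bracket v w) + bracket v (bracket w u)
  + bracket w (bracket u v) = 0.
Proof. by apply: V4P; rewrite !mxE /=; ring. Qed.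

Fact lorentz_formE A u v : lorentz_form A u v =
  - (u 0 0 * v 0 0) + u 0 1 * v 0 1
  + (u 0 2 * A 0 0 + u 0 3 * A 1 0) * v 0 2
  + (u 0 2 * A 0 1 + u 0 3 * A 1 1) * v 0 3.
Proof.
rewrite /lorentz_form !mxE !big_ord_recl big_ord0 !mxE !big_ord_recl !big_ord0.
rewrite !mxE /=.
have -> : lift ord0 ord0 = 1 :> 'I_4 by apply/val_inj.
have -> : lift ord0 (lift ord0 ord0) = 2 :> 'I_4 by apply/val_inj.
have -> : lift ord0 (lift ord0 (lift ord0 ord0)) = 3 :> 'I_4 by apply/val_inj.
have -> : ord0 = 0 :> 'I_4 by apply/val_inj.
ring.
Qed.

Fact posdef_facts A :
  posdef A -> [/\ A 1 0 = A 0 1, 0 < A 0 0 & 0 < A 0 0 * A 1 1 - A 0 1 ^+ 2].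
Proof.
move=> [symA posA].
have A10 : A 1 0 = A 0 1 by rewrite -{1}symA mxE.
have formE (x : 'cV[R]_2) : (x^T *m A *m x) 0 0 = x 0 0 ^+ 2 * A 0 0
    + x 0 0 * x 1 0 * (A 0 1 + A 1 0) + x 1 0 ^+ 2 * A 1 1.
  rewrite !mxE !big_ord_recl big_ord0 !mxE !big_ord_recl !big_ord0 !mxE /=.
  have -> : lift ord0 ord0 = 1 :> 'I_2 by apply/val_inj.
  have -> : ord0 = 0 :> 'I_2 by apply/val_inj.
  ring.
have a0 : 0 < A 0 0.
  have := posA (delta_mx 0 0); rewrite formE !mxE /=.
  rewrite [X in 0 < X](_ : _ = A 0 0); last by ring.
  apply; apply/eqP => /matrixP /(_ 0 0); rewrite !mxE /=.
  by move/eqP; rewrite oner_eq0.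
split=> //; rewrite -(pmulr_rgt0 _ a0).
have := posA (\col_i (if i == 0 then - A 0 1 else A 0 0)).
rewrite formE !mxE /= A10.
rewrite [X in 0 < X](_ : _ = A 0 0 * (A 0 0 * A 1 1 - A 0 1 ^+ 2)); last by ring.
apply; apply/eqP => /matrixP /(_ 1 0); rewrite !mxE /= => a_eq0.
by rewrite a_eq0 ltxx in a0.
Qed.

Fact levi_civita_ex A : posdef A ->
  exists nabla : {bilinear 'rV[R]_4 -> 'rV[R]_4 -> 'rV[R]_4},
    levi_civita bracket (lorentz_form A) nabla.
Proof.
move=> /posdef_facts[A10 a0 d0].
move: (lorentz_formE A); rewrite A10.
move: (A 0 0) (A 0 1) (A 1 1) a0 d0 => a b c a0 d0 gE.
pose g := lorentz_form A.
pose k u v w := g (bracket u v) w + g (bracket w u) v + g (bracket w v) u.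
pose d := a * c - b ^+ 2.
pose nab u v : 'rV[R]_4 := 2^-1 *: (- k u v 'e_0 *: 'e_0 + k u v 'e_1 *: 'e_1
  + ((c * k u v 'e_2 - b * k u v 'e_3) / d) *: 'e_2
  + ((a * k u v 'e_3 - b * k u v 'e_2) / d) *: 'e_3).
have dn0 : d != 0 by rewrite gt_eqF.
have brE u v w : g (bracket u v) w =
    (u 0 0 * v 0 1 - u 0 1 * v 0 0) * (a * w 0 2 + b * w 0 3)
    + (u 0 0 * v 0 2 - u 0 2 * v 0 0) * (b * w 0 2 + c * w 0 3).
  by rewrite /g gE !mxE /=; ring.
have kDl x u u' v w : k (x *: u + u') v w = x * k u v w + k u' v w.
  by rewrite /k !brE !mxE; ring.
have kDr x u v v' w : k u (x *: v + v') w = x * k u v w + k u v' w.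
  by rewrite /k !brE !mxE; ring.
have kE u v w : k u v w = k u v 'e_0 * w 0 0 + k u v 'e_1 * w 0 1
    + k u v 'e_2 * w 0 2 + k u v 'e_3 * w 0 3.
  by rewrite /k !brE !mxE /= ?(mulr0, mulr1, addr0, add0r); ring.
have nab_bil : bilinear_for *:%R *:%R nab.
  split=> [v|u] x w w'; rewrite /nab ?kDl ?kDr; apply: V4P;
    by rewrite !mxE /= ?(mulr0, mulr1, addr0, add0r); ring.
pose B := bilinear_isBilinear.Build R _ _ _ *:%R *:%R nab nab_bil.
pose nabla : {bilinear _ -> _ -> _} := HB.pack nab B.
exists nabla => u v w; rewrite -/g.
rewrite -/(k u v w) kE /= /nab /g gE !mxE /=.
by move: (k _ _ _) (k _ _ _) (k _ _ _) (k _ _ _) dn0; rewrite /d => *; field.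
Qed.

Fact product_structure_ex A : exists J, product_structure A J.
Proof.
pose j u : 'rV[R]_4 := u - (2 * u 0 0) *: 'e_0.
have j_lin : linear j by move=> k u v; apply: V4P; rewrite !mxE /=; ring.
pose B := GRing.isLinear.Build R _ _ _ j j_lin.
pose J : {linear _ -> _} := HB.pack j B.
by exists J; split; apply: V4P; rewrite /= /j !mxE /=; ring.
Qed.

End G4.

(* Main.v *)
(* Let H = <e_2, e_3, e_4>, an abelian ideal, be the +1-eigenspace of J; the
   -1-eigenspace is the line of e_1.  On each eigenspace nabla^1 is the
   projection of nabla, which vanishes on H x H since H is abelian and on
   e_1 x e_1 since [e_1, _] lies in H; across the eigenspaces nabla^1_u v is the
   projection of [u, v] onto the eigenspace of v.  Hence nabla^1_u v is the
   e_1-coordinate of u times [e_1, v].  Any two nabla^1_u therefore commute, and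
   nabla^1_[u,v] = 0 because [g, g] lies in H. *)
Require Import Defs.
From mathcomp Require Import all_boot all_order all_algebra reals.
From mathcomp Require Import ring.
Import Order.TTheory GRing.Theory Num.Theory.
Local Open Scope ring_scope.

Lemma row4P (T : Type) (x y : 'rV[T]_4) :
  x 0 0 = y 0 0 -> x 0 1 = y 0 1 -> x 0 2 = y 0 2 -> x 0 3 = y 0 3 -> x = y.
Proof.
move=> h0 h1 h2 h3; apply/rowP => -[[|[|[|[|//]]]] hi].
- by rewrite (_ : Ordinal hi = 0)//; apply/val_inj.
- by rewrite (_ : Ordinal hi = 1)//; apply/val_inj.
- by rewrite (_ : Ordinal hi = 2)//; apply/val_inj.
- by rewrite (_ : Ordinal hi = 3)//; apply/val_inj.
Qed.

(** Positivity of [a] and [d] makes the square roots nonzero, so [v2] and then [v3] force [J] to fix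
    e_3 and e_4. *)
Lemma product_structureE (R : realType) (A : 'M[R]_2)
    (J : {linear 'rV[R]_4 -> 'rV[R]_4}) (u : 'rV[R]_4) :
  posdef A -> product_structure A J -> J u = u - (2 * u 0 0) *: 'e_0.
Proof.
move=> /posdef_facts[_ a0 d0] [J1 J2 J3 J4].
have Je2 : J 'e_2 = 'e_2.
  apply: (scalerI (a := (Num.sqrt (A 0 0))^-1)).
    by rewrite invr_eq0 sqrtr_eq0 -ltNge.
  by rewrite -linearZ.
have Je3 : J 'e_3 = 'e_3.
  (* The e_3-part of [v3] is already fixed by [J] and cancels. *)
  have := J3; rewrite /v3 linearD !linearZ Je2 => /addrI; apply: scalerI.
  by rewrite sqrtr_eq0 -ltNge divr_gt0.
have {1}-> : u = u 0 0 *: 'e_0 + u 0 1 *: 'e_1 + u 0 2 *: 'e_2 + u 0 3 *: 'e_3.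
  by apply: row4P; rewrite !mxE /=; ring.
rewrite !linearD !linearZ Je2 Je3 [J _]J4 [J 'e_1]J1 /v4 /v1.
by apply: row4P; rewrite !mxE /=; ring.
Qed.

(** Here [p], [q] are the coordinates of [u,v], and [r] is <[u,e_3],v> + <[v,e_3],u>. As e_4 is
    central, [r] enters only the Koszul formula tested on e_3. *)
Lemma levi_civita_coord (R : realType) (A : 'M[R]_2)
    (nabla : {bilinear 'rV[R]_4 -> 'rV[R]_4 -> 'rV[R]_4}) (u v : 'rV[R]_4)
    (a := A 0 0) (b := A 0 1) (c := A 1 1) (d := a * c - b ^+ 2)
    (p := u 0 0 * v 0 1 - u 0 1 * v 0 0) (q := u 0 0 * v 0 2 - u 0 2 * v 0 0)
    (r := u 0 0 * (b * v 0 2 + c * v 0 3) + v 0 0 * (b * u 0 2 + c * u 0 3)) :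
  posdef A -> levi_civita (@bracket R) (lorentz_form A) nabla ->
  [/\ nabla u v 0 0 = - 2^-1 *
        (u 0 1 * (a * v 0 2 + b * v 0 3) + u 0 2 * (b * v 0 2 + c * v 0 3)
         + v 0 1 * (a * u 0 2 + b * u 0 3) + v 0 2 * (b * u 0 2 + c * u 0 3)),
      nabla u v 0 1 = - 2^-1 *
        (u 0 0 * (a * v 0 2 + b * v 0 3) + v 0 0 * (a * u 0 2 + b * u 0 3)),
      nabla u v 0 2 = 2^-1 * (p - c * r / d) &
      nabla u v 0 3 = 2^-1 * (q + b * r / d)].
Proof.
move=> /posdef_facts[A10 _ d0] LC.
have dn0 : a * c - b ^+ 2 != 0 by rewrite gt_eqF.
(* Inverts the Gram matrix, whose block A has determinant [d]. *)
have solve (w0 w1 w2 w3 k0 k1 k2 k3 : R) :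
    2 * - w0 = k0 -> 2 * w1 = k1 ->
    2 * (w2 * a + w3 * b) = k2 -> 2 * (w2 * b + w3 * c) = k3 ->
    [/\ w0 = - (k0 / 2), w1 = k1 / 2, w2 = (c * k2 - b * k3) / (2 * d)
      & w3 = (a * k3 - b * k2) / (2 * d)].
  by rewrite /d => <- <- <- <-; split; field; rewrite ?dn0.
have := LC u v 'e_3; have := LC u v 'e_2.
have := LC u v 'e_1; have := LC u v 'e_0.
rewrite !lorentz_formE A10 -/a -/b -/c !mxE /=.
rewrite ?(mulr0, mulr1, addr0, add0r, mul0r, oppr0) => h0 h1 h2 h3.
have [-> -> -> ->] := solve _ _ _ _ _ _ _ _ h0 h1 h2 h3.
by rewrite /p /q /r /d; split; field; rewrite ?dn0.
Qed.

Lemma kobayashi_nomizuE (R : realType) (A : 'M[R]_2)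
    (J : {linear 'rV[R]_4 -> 'rV[R]_4})
    (nabla : {bilinear 'rV[R]_4 -> 'rV[R]_4 -> 'rV[R]_4}) (u v : 'rV[R]_4) :
  posdef A -> product_structure A J ->
  levi_civita (@bracket R) (lorentz_form A) nabla ->
  kobayashi_nomizu nabla J u v = u 0 0 *: bracket 'e_0 v.
Proof.
move=> posA JA LC.
have [_ _ d0] := posdef_facts posA.
have dn0 : A 0 0 * A 1 1 - A 0 1 ^+ 2 != 0 by rewrite gt_eqF.
have JE w := product_structureE _ _ _ w posA JA.
(* The formulas are kept for all arguments, since [nabla] also occurs at images under [J]. *)
have [N0 N1 N2 N3] := all_and4 (fun x => all_and4 (fun y =>
  levi_civita_coord _ _ _ x y posA LC)).
rewrite /kobayashi_nomizu /canonical_connection /cov_deriv !JE.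
by apply: row4P; rewrite !(mxE, N0, N1, N2, N3) /=; field.
Qed.

Theorem theorem3p24 (R : realType) (A : 'M[R]_2)
    (J : {linear 'rV[R]_4 -> 'rV[R]_4})
    (nabla : {bilinear 'rV[R]_4 -> 'rV[R]_4 -> 'rV[R]_4}) :
  posdef A ->
  product_structure A J ->
  levi_civita (@bracket R) (lorentz_form A) nabla ->
  flat (@bracket R) (kobayashi_nomizu nabla J).
Proof.
move=> posA JA LC u v w.
have E x y := kobayashi_nomizuE _ _ _ _ x y posA JA LC.
by rewrite /curvature !E; apply: row4P; rewrite !mxE /=; ring.
Qed.
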